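(* For every integer $m\ge 1$ there exists a complete $3$-AP-free set $A\subseteq\mathbb{Z}_m$ such that $$|A|<2\sqrt m .$$ Moreover, for every $m\ge 81$ the set $A$ may be chosen complete $(2,-1)$-avoiding (in $\mathbb{Z}_m$). In particular, $$a(3\text{-}\mathrm{AP},\mathbb{Z}_m)<2\sqrt m\qquad (m\ge 1)$$ and $$a_{(2,-1)}(\mathbb{Z}_m)<2\sqrt m\qquad (m\ge 81).$$
   Context: $\mathbb{Z}_m=\mathbb{Z}/m\mathbb{Z}$ is the cyclic group of order $m$, written additively. Let $G$ be an abelian group, written additively. A $3$-term arithmetic progression ($3$-AP) in $G$ is a set of three distinct elements of the form $g,\ g+d,\ g+2d$ with $g,d\in G$. A subset of $G$ is $3$-AP-free if it contains no $3$-AP; it is complete $3$-AP-free if it is $3$-AP-free and maximal (with respect to inclusion among subsets of $G$) with this property. For $A\subseteq G$ put $2A\mathbin{\dot{-}}A=\{2a-b:\ a,b\in A,\ a\ne b\}$. The set $A$ is $(2,-1)$-avoiding if $A\cap(2A\mathbin{\dot{-}}A)=\emptyset$, and complete $(2,-1)$-avoiding (in $G$) if, in addition, $G=A\cup(2A\mathbin{\dot{-}}A)$. $a(3\text{-}\mathrm{AP},G)$ denotes the minimum size of a complete $3$-AP-free subset of $G$, and $a_{(2,-1)}(G)$ denotes the minimum size of a complete $(2,-1)$-avoiding subset of $G$, with the convention $a_{(2,-1)}(G)=\infty$ if no such set exists. *)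

(* Defs.v *)
From HB Require Import structures.
From mathcomp Require Import all_boot all_order all_algebra.
From mathcomp Require Import reals constructive_ereal.

Set Implicit Arguments.
Unset Strict Implicit.
Unset Printing Implicit Defensive.

Import Order.TTheory GRing.Theory Num.Theory.
Local Open Scope ring_scope.

(* The cyclic group of order m, for m >= 1. The type 'Z_m is not used because
   'Z_1 is convertible to 'Z_2. *)
Notation Zmod m := ('I_m.-1.+1) (only parsing).

Section AbelianGroup.
Variable G : finZmodType.
Implicit Types A S : {set G}.

Definition is_3AP S : bool :=
  (#|S| == 3%N) && [exists g : G, exists d : G, S == [set g; g + d; g + d *+ 2]].

Definition free_3AP A : bool := [forall S : {set G}, is_3AP S ==> ~~ (S \subset A)].

Definition complete_free_3AP A : bool := maxset free_3AP A.

Definition dotdiff2 A : {set G} := [set a *+ 2 - b | a in A, b in A & a != b].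

Definition avoiding21 A : bool := A :&: dotdiff2 A == set0.

Definition complete_avoiding21 A : bool :=
  avoiding21 A && ([set: G] == A :|: dotdiff2 A).

End AbelianGroup.

(* Minimum size of a subset of G satisfying P, and +oo if there is none. *)
Definition min_size (R : realType) (G : finZmodType) (P : pred {set G}) : \bar R :=
  \big[Order.min/+oo%E]_(A : {set G} | P A) (#|A|%:R)%:E.

Definition a_3AP (R : realType) (G : finZmodType) : \bar R :=
  min_size R (@complete_free_3AP G).

Definition a_21 (R : realType) (G : finZmodType) : \bar R :=
  min_size R (@complete_avoiding21 G).

(* Main.v *)
Require Import Defs.
From HB Require Import structures.
From mathcomp Require Import all_boot all_order all_algebra.
From mathcomp Require Import reals constructive_ereal.
From mathcomp Require Import zify.

(** The digits [0, 1] are perfect in base 4: the values of [2 * e - f] for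
    [e, f] in {0, 1} are -1, 0, 1, 2, one for each residue modulo 4.  Hence the
    2 ^ n integers whose n base-4 digits are 0 or 1 represent every residue
    modulo 4 ^ n exactly once as [2 * a - b].  The proof deforms this set so
    that it fits every modulus m of a whole interval.  Replace the weights 4 ^ i
    by general weights [s_1, ..., s_n], and let A be the set of their subset
    sums, with total S.  The integers [2 * a - b] then are the sums of the s_i
    with coefficients in {-1, 0, 1, 2}.  They fill [-S, 2 * S] as long as each
    weight is at most [3 * S' + 1], where S' is the sum of the smaller ones.  On
    the other hand a relation [2 * a = b + c] forces [a = b = c] as soon as the
    sums with coefficients in {0, 1, 2} are distinct, that is, as soon as each
    weight exceeds [2 * S'].  Both properties survive modulo m when
    [2 * S + 1 <= m <= 3 * S + 1], and then A is complete (2,-1)-avoiding in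
    Z_m ([tiling_set_step], [tiling_set_residues]).

    The two conditions on the weights leave room for every total S between
    [(3 ^ n - 1) / 2] and [(4 ^ n - 1) / 3] ([tiling_set_exists]), and so for
    every modulus with [3 ^ n <= m <= 4 ^ n].  If [4 ^ (n - 1) < m <= 4 ^ n],
    the size 2 ^ n is less than [2 * sqrt m].  For [m >= 81] this n also satisfies
    [3 ^ n <= m]: at [n = 4] because 81 = 3 ^ 4, and for [n >= 5] because
    [3 ^ n <= 4 ^ (n - 1)].

    The moduli between 4 ^ (n - 1) and 3 ^ n that remain (2, 5 to 8, 17 to 26
    and 65 to 80) are finite in number.  For each of them the greedy 3-AP-free
    set, which adds 0, 1, 2, ... whenever possible, is small enough, by
    computation ([small_moduli_greedy]). *)

Set Implicit Arguments.
Unset Strict Implicit.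
Unset Printing Implicit Defensive.

Import Order.TTheory GRing.Theory Num.Theory.
Local Open Scope ring_scope.

(** * Criteria for completeness in a finite abelian group *)

Section Closing.
Variable G : finZmodType.
Implicit Types (A S : {set G}) (x : G).

(** [x] and [a] lie on a 3-AP with its third point in [A]: either [x] is an end
    and [a] the middle, or the other way round.  The case in which both are ends
    is found from the middle point instead of [a].  The disequalities matter when
    the group has elements of order 2, for which [a *+ 2 - x] may be [x]. *)
Definition closes_with A x a : bool :=
     (let b := a *+ 2 - x in [&& b \in A, b != a & b != x])
  || (let b := x *+ 2 - a in [&& b \in A, b != a & b != x]).

Definition closes A x : bool := [exists a in A, closes_with A x a].

Lemma is_3AP_set3 (a b c : G) :
  c = b *+ 2 - a -> c != b -> c != a -> is_3AP [set a; b; c].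
Proof.
move=> eq_c neq_cb neq_ca; have neq_ab : a != b.
  by apply: contraNneq neq_cb => eq_ab; rewrite eq_c eq_ab mulr2n addrK.
apply/andP; split.
  rewrite -setUA !cardsU1 cards1 !inE (eq_sym b) (eq_sym a c).
  by rewrite (negbTE neq_cb) (negbTE neq_ca) (negbTE neq_ab).
apply/existsP; exists a; apply/existsP; exists (b - a).
by rewrite addrC subrK mulrnBl [_ *+ 2 in X in _ - X]mulr2n addrC opprD addrA
  subrK -eq_c.
Qed.

(** One condition on every point [x] expresses both halves of completeness: for
    [x] in [A] it says that no 3-AP of [A] passes through [x], and for [x] outside
    [A] that adding [x] creates one.  This form can be tested by computation. *)
Lemma complete_free_3AP_closes A :
  (forall x, (x \in A) = ~~ closes A x) -> complete_free_3AP A.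
Proof.
move=> AE; apply/maxsetP; split.
  apply/forallP=> S; apply/implyP=> /andP[/eqP card_S].
  case/existsP=> g /existsP[d /eqP SE]; apply/negP=> /subsetP sSA.
  have inA y : y \in [set g; g + d; g + d *+ 2] -> y \in A.
    by rewrite -SE; apply: sSA.
  have /inA: g \in [set g; g + d; g + d *+ 2] by rewrite !inE eqxx.
  rewrite AE => /negP; apply; apply/existsP; exists (g + d).
  have gdd : (g + d) *+ 2 - g = g + d *+ 2.
    by rewrite mulrnDl mulr2n addrC !addrA addNr add0r.
  have neq2 y z : S <> [set y; z].
    by move=> SE2; move: card_S; rewrite SE2 cards2; case: (_ == _).
  rewrite /closes_with gdd [_ \in A]inA ?inE ?eqxx ?orbT //=; apply/orP; left.
  rewrite [_ \in A]inA ?inE ?eqxx ?orbT //=; apply/andP; split.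
    by apply/eqP=> eq_g; apply: (neq2 g (g + d)); rewrite SE eq_g -setUA setUid.
  by apply/eqP=> eq_g; apply: (neq2 g (g + d)); rewrite SE eq_g setUAC setUid.
move=> B free_B sAB; apply/eqP; rewrite eqEsubset sAB andbT.
apply/subsetP=> x xB; rewrite AE; apply/negP=> /existsP[a /andP[aA]].
have aB : a \in B by apply: (subsetP sAB).
case/orP=> /and3P[/(subsetP sAB) bB neq_ba neq_bx].
  have := forallP free_B [set x; a; a *+ 2 - x].
  rewrite is_3AP_set3 //= => /negP; apply.
  by apply/subsetP=> y; rewrite !inE => /orP[/orP[]|] /eqP->.
have := forallP free_B [set a; x; x *+ 2 - a].
rewrite is_3AP_set3 //= => /negP; apply.
by apply/subsetP=> y; rewrite !inE => /orP[/orP[]|] /eqP->.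
Qed.

(** In the (2,-1) notion a new point must be an end of a 3-AP, whereas for
    maximality it may also be the middle; and avoidance excludes the degenerate
    relation [a *+ 2 - b = b] with [a != b], which is not a 3-AP. *)
Lemma complete_avoiding21_free_3AP A :
  complete_avoiding21 A -> complete_free_3AP A.
Proof.
case/andP=> /eqP avA /eqP covA; have avoid a b : a \in A -> b \in A ->
    a *+ 2 - b \in A -> a = b.
  move=> aA bA cA; apply/eqP; apply: contraTT isT => neq_ab.
  have: a *+ 2 - b \in A :&: dotdiff2 A.
    by rewrite inE cA; apply/imset2P; exists a b; rewrite // inE bA.
  by rewrite avA inE.
apply: complete_free_3AP_closes => x; apply/idP/idP.
  move=> xA; apply/negP=> /existsP[a /andP[aA]].
  case/orP=> /and3P[bA].
    by rewrite (avoid _ _ aA xA bA) mulr2n addrK eqxx.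
  by rewrite (avoid _ _ xA aA bA) mulr2n addrK eqxx.
move=> clN; have: x \in A :|: dotdiff2 A by rewrite -covA inE.
rewrite inE => /orP[//|/imset2P[a b aA]]; rewrite inE => /andP[bA neq_ab] eq_x.
apply: contraNT clN => xA; apply/existsP; exists a; rewrite aA /=.
rewrite /closes_with.
have -> : a *+ 2 - x = b by rewrite eq_x opprB addrC subrK.
by rewrite bA eq_sym neq_ab /=; apply/orP; left; apply: contraNneq xA => <-.
Qed.
End Closing.

(** * Comparing cardinals with [2 * sqrt m] *)

Lemma lt_2sqrt (R : realType) (k m : nat) : (k ^ 2 < 4 * m)%N ->
  k%:R < 2 * Num.sqrt (m%:R : R).
Proof.
move=> lt_k; rewrite -(@ltr_pXn2r _ 2) // ?nnegrE ?ler0n //.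
  by rewrite exprMn sqr_sqrtr ?ler0n // -!natrX -natrM ltr_nat.
by rewrite mulr_ge0 ?ler0n ?sqrtr_ge0.
Qed.

Lemma min_size_lt (R : realType) (G : finZmodType) (P : pred {set G}) A (x : R) :
  P A -> #|A|%:R < x -> (min_size R P < x%:E)%E.
Proof.
move=> PA ltA.
apply: le_lt_trans (_ : (#|A|%:R)%:E < _)%E; last by rewrite lte_fin.
exact: (@bigmin_le_cond _ _ _ _ A P (fun A => (#|A|%:R)%:E : \bar R)).
Qed.

(** * Small moduli: greedy sets *)

(** The arithmetic of Z_n on representatives in [0, n), so that [closes_with]
    can be evaluated. *)
Definition closes_mod_with (n : nat) (l : seq nat) (x a : nat) : bool :=
     (let b := ((a + a + (n - x)) %% n)%N in [&& b \in l, b != a & b != x])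
  || (let b := ((x + x + (n - a)) %% n)%N in [&& b \in l, b != a & b != x]).

Definition closes_mod (n : nat) (l : seq nat) (x : nat) : bool :=
  has (closes_mod_with n l x) l.

Section Residues.
Variable p : nat.
Local Notation m := p.+1.
Implicit Types (a b x : 'I_m) (l : seq nat).

Definition residues l : {set 'I_m} := [set x : 'I_m | (x : nat) \in l].

Lemma card_residues l : (#|residues l| <= size l)%N.
Proof.
rewrite cardE -(size_map (@nat_of_ord m)); apply: uniq_leq_size.
  by rewrite map_inj_uniq ?enum_uniq //; apply: val_inj.
by move=> k /mapP[x]; rewrite mem_enum inE => xl ->.
Qed.

Lemma val_third a b : (a *+ 2 - b : 'I_m) = ((a + a + (m - b)) %% m)%N :> nat.
Proof. by rewrite mulr2n /= modnDml modnDmr. Qed.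

Lemma closes_residues l x :
  all (fun a : nat => a < m)%N l -> closes (residues l) x = closes_mod m l x.
Proof.
have withE a : closes_with (residues l) x a = closes_mod_with m l x a.
  by rewrite /closes_with !inE /closes_mod_with -!val_third.
move/allP=> lt_l; apply/existsP/hasP.
  by case=> a /andP[]; rewrite inE withE => al; exists (nat_of_ord a).
by case=> a al cl; exists (Ordinal (lt_l a al)); rewrite inE withE al.
Qed.

End Residues.

Definition greedy_residues (m : nat) : seq nat :=
  foldl (fun l (x : nat) => if closes_mod m l x then l else x :: l)
        [::] (iota 0 m).

(** Completeness of the greedy set is checked afterwards rather than derived from
    its construction. *)
Definition greedy_ok (m : nat) : bool :=
  let l := greedy_residues m in
  [&& all (fun a : nat => a < m) l,
      all (fun x : nat => (x \in l) == ~~ closes_mod m l x) (iota 0 m)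
    & size l ^ 2 < 4 * m]%N.

Lemma greedy_complete (p : nat) : greedy_ok p.+1 ->
  exists A : {set 'I_p.+1}, complete_free_3AP A /\ (#|A| ^ 2 < 4 * p.+1)%N.
Proof.
case/and3P=> lt_l /allP closed_l lt_size.
exists (residues p (greedy_residues p.+1)); split.
  apply: complete_free_3AP_closes => x; rewrite closes_residues // inE.
  by apply/eqP/closed_l; rewrite mem_iota ltn_ord.
by apply: leq_ltn_trans lt_size; rewrite leq_sqr card_residues.
Qed.

(** Without the first alternative the claim would fail: the greedy set modulo 54
    is too large, but 54 lies between 3 ^ 3 and 4 ^ 3. *)
Lemma small_moduli_greedy m : (0 < m < 81)%N ->
  (3 ^ up_log 4 m <= m)%N || greedy_ok m.
Proof.
move=> m_range; have: m \in iota 1 80 by rewrite mem_iota.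
by move: m {m_range}; apply/allP; vm_compute.
Qed.

(** * Integer sets of subset sums *)

Local Open Scope nat_scope.

(** The last clause says that [2 * a - b] takes all the values of [-S, 2 * S],
    written with [x - S] for the value so as to stay in the natural numbers. *)
Definition tiling_set (l : seq nat) (S : nat) : Prop :=
  [/\ forall a, a \in l -> a <= S,
      forall a b c, a \in l -> b \in l -> c \in l -> a + a = b + c -> a = b
    & forall x, x <= 3 * S ->
        exists a b, [/\ a \in l, b \in l & x + b = a + a + S]].

(** Adjoining the weight [s].  If [2 * S < s], then [2 * a - b - c], whose part
    from [l] is at most [2 * S] in absolute value, can vanish only if the
    coefficient of [s] vanishes.  If [s <= 3 * S + 1], the four translates of
    [-S, 2 * S] by [- s, 0, s, 2 * s] overlap or abut. *)
Lemma tiling_set_step l S s : tiling_set l S -> 2 * S < s <= 3 * S + 1 ->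
  tiling_set (l ++ map (addn s) l) (S + s).
Proof.
case=> le_l avoid cover s_range.
have mem_step e a : a \in l -> (e : bool) * s + a \in l ++ map (addn s) l.
  move=> al; rewrite mem_cat; case: e => /=; rewrite ?mul1n ?mul0n ?al //.
  by apply/orP; right; apply: map_f.
have stepP a : a \in l ++ map (addn s) l ->
    exists (e : bool) a0, a0 \in l /\ a = e * s + a0.
  rewrite mem_cat => /orP[al|/mapP[a0 al ->]]; first by exists false, a.
  by exists true, a0; rewrite mul1n.
split.
- by move=> a /stepP[e [a0 [/le_l le_a ->]]]; case: e; lia.
- move=> _ _ _ /stepP[e [a [al ->]]] /stepP[f [b [bl ->]]] /stepP[g [c [cl ->]]].
  have := (le_l a al, le_l b bl, le_l c cl) => -[[le_a le_b] le_c] eq_abc.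
  have eq0 : a + a = b + c by case: e f g eq_abc => [] [] []; lia.
  have eq_ab := avoid a b c al bl cl eq0.
  by case: e f g eq_abc => [] [] []; lia.
move=> x le_x.
(* The translate with coefficient [2 * e - f], shifted by [S + s]. *)
have from_piece (e f : bool) :
    (1 + 2 * e - f) * s <= x <= (1 + 2 * e - f) * s + 3 * S ->
    exists a b, [/\ a \in l ++ map (addn s) l, b \in l ++ map (addn s) l
                  & x + b = a + a + (S + s)].
  move=> x_range; have le_y: x - (1 + 2 * e - f) * s <= 3 * S by lia.
  have [a [b [al bl eq_y]]] := cover _ le_y.
  exists (e * s + a), (f * s + b); split; try exact: mem_step.
  by case: e f x_range eq_y {le_y} => [] []; lia.
have [lt1|ge1] := ltnP x s; first by apply: (from_piece false true); lia.
have [lt2|ge2] := ltnP x (2 * s); first by apply: (from_piece false false); lia.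
have [lt3|ge3] := ltnP x (3 * s); first by apply: (from_piece true true); lia.
by apply: (from_piece true false); lia.
Qed.

(** The last weight is [S - S'] for the previous total [S'], and it is admissible
    iff [3 * S' + 1 <= S <= 4 * S' + 1].  The smallest [S'] that satisfies the
    upper inequality and the lower bound [(3 ^ n - 1) / 2] works. *)
Lemma tiling_set_exists n S : 3 ^ n <= 2 * S + 1 -> 3 * S + 1 <= 4 ^ n ->
  exists l, size l = 2 ^ n /\ tiling_set l S.
Proof.
elim: n S => [|n IHn] S lbS ubS.
  exists [:: 0]; split=> //; have -> : S = 0 by lia.
  split=> [a||x]; first by rewrite inE => /eqP->.
    by move=> a b c; rewrite !inE => /eqP-> /eqP->.
  by rewrite leqn0 => /eqP->; exists 0, 0; rewrite !inE.
have [S' [lbS' ubS' lb ub]] : exists S', [/\ 3 ^ n <= 2 * S' + 1,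
    3 * S' + 1 <= 4 ^ n, 3 * S' + 1 <= S & S <= 4 * S' + 1].
  have odd3 : 3 ^ n = 2 * (3 ^ n)./2 + 1.
    by rewrite -[LHS]odd_double_half oddX orbT -mul2n addnC.
  have odd4 : 4 ^ n %% 3 = 1 by rewrite -modnXm exp1n.
  have lt34 : 3 ^ n.+1 <= 2 * 4 ^ n + 1.
    elim: n {IHn lbS ubS odd3 odd4} => // n IHn; rewrite expnS (expnS 4).
    by have := expn_gt0 4 n; lia.
  (* For [6 <= S <= 9] the smallest [S'] with [S <= 4 * S' + 1] is 2, and
     [3 * 2 + 1 <= S] may fail; the bounds on [S] skip these values. *)
  have small : S <= 1 \/ 4 <= S <= 5 \/ 13 <= S.
    case: n lbS ubS {IHn odd3 odd4 lt34} => [|[|n]] lbS ubS.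
    + by left; rewrite expn1 in ubS; lia.
    + by right; left; lia.
    + by right; right; rewrite !expnS in lbS; have := expn_gt0 3 n; lia.
  rewrite expnS in lbS lt34; rewrite expnS in ubS.
  exists (maxn ((S + 2) %/ 4) (3 ^ n)./2); split; lia.
have [l [size_l tile_l]] := IHn _ lbS' ubS'.
exists (l ++ map (addn (S - S')) l); split.
  by rewrite size_cat size_map size_l expnS mul2n addnn.
have -> : S = S' + (S - S') by lia.
rewrite [in map _ _](_ : S' + (S - S') - S' = S - S'); last by lia.
by apply: tiling_set_step => //; lia.
Qed.

(** As [2 * S < m], relations [2 * a = b + c] modulo m hold in the integers; as
    [m <= 3 * S + 1], the interval [-S, 2 * S] meets every residue class. *)
Lemma tiling_set_residues p l S :
    tiling_set l S -> 2 * S + 1 <= p.+1 <= 3 * S + 1 ->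
  complete_avoiding21 (residues p l).
Proof.
case=> le_l avoid cover /andP[lb ub].
have third_eq (a b c : 'I_p.+1) :
    (a *+ 2 - b = c)%R <-> a + a = b + c %[mod p.+1].
  split=> [eq_c|eq_abc].
    have -> : c = (a + a + (p.+1 - b)) %% p.+1 :> nat.
      by rewrite -val_third -eq_c.
    rewrite modnDmr addnCA subnKC ?modnDr //; exact: ltnW.
  apply: val_inj; apply: etrans (val_third a b) _; rewrite -modnDml eq_abc modnDml.
  by rewrite addnAC subnKC ?modnDl ?modn_small //; exact: ltnW.
apply/andP; split.
  apply/eqP/setP=> c; rewrite !inE; apply/negP=> /andP[cl].
  case/imset2P=> a b; rewrite !inE => al /andP[bl /eqP neq_ab].
  move/esym/third_eq.
  have := (le_l _ al, le_l _ bl, le_l _ cl) => -[[le_a le_b] le_c].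
  rewrite !modn_small; try lia.
  by move/(avoid _ _ _ al bl cl)/val_inj.
apply/eqP/esym/eqP; rewrite -subTset; apply/subsetP=> y _; rewrite !inE.
have le_x : (y + S) %% p.+1 <= 3 * S by have := ltn_pmod (y + S) (ltn0Sn p); lia.
have [a [b [al bl eq_x]]] := cover _ le_x.
have lt_a : a < p.+1 by have := le_l a al; lia.
have lt_b : b < p.+1 by have := le_l b bl; lia.
have eq_y : (Ordinal lt_a *+ 2 - Ordinal lt_b)%R = y.
  apply/third_eq => /=; apply/eqP; rewrite -(eqn_modDr S) -eq_x modnDml.
  by rewrite addnAC (addnC y).
have [eq_ab|neq_ab] := eqVneq a b.
  have eq_ya : y = Ordinal lt_a.
    have eq_ba : Ordinal lt_b = Ordinal lt_a by apply: val_inj.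
    by rewrite -eq_y mulr2n -addrA eq_ba subrr addr0.
  by rewrite eq_ya /= al.
apply/orP; right; apply/imset2P.
by exists (Ordinal lt_a) (Ordinal lt_b); rewrite ?inE ?al ?bl.
Qed.

(** * Large moduli *)

Lemma complete_avoiding21_exists p n : 3 ^ n <= p.+1 <= 4 ^ n ->
  exists A : {set 'I_p.+1}, complete_avoiding21 A /\ #|A| <= 2 ^ n.
Proof.
case/andP=> lb ub.
have odd3 : 3 ^ n = 2 * (3 ^ n)./2 + 1.
  by rewrite -[LHS]odd_double_half oddX orbT -mul2n addnC.
have odd4 : 4 ^ n %% 3 = 1 by rewrite -modnXm exp1n.
have le34 : 3 * 3 ^ n <= 2 * 4 ^ n + 1.
  elim: n {lb ub odd3 odd4} => // n IHn; rewrite (expnS 3) (expnS 4).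
  by have := expn_gt0 4 n; lia.
(* [2 * S + 1 <= m] fails at [m = 2] for the total chosen below. *)
have p_range : p <= 0 \/ 2 <= p.
  case: n lb ub {odd3 odd4 le34} => [|n] lb ub; first by lia.
    by right; rewrite expnS in lb; have := expn_gt0 3 n; lia.
have [S [lbS ubS S_range]] : exists S,
    [/\ 3 ^ n <= 2 * S + 1, 3 * S + 1 <= 4 ^ n & 2 * S + 1 <= p.+1 <= 3 * S + 1].
  by exists (maxn ((p + 2) %/ 3) (3 ^ n)./2); split; lia.
have [l [size_l tile_l]] := tiling_set_exists lbS ubS.
exists (residues p l); split; first exact: tiling_set_residues tile_l S_range.
by rewrite -size_l card_residues.
Qed.

Lemma up_log4_sqr m : 0 < m -> (2 ^ up_log 4 m) ^ 2 < 4 * m.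
Proof.
case: m => [|[|m]] // _.
have /andP[lt_m _] := @up_log_bounds 4 m.+2 isT isT.
have := up_log_gt0 4 m.+2; case: (up_log 4 m.+2) lt_m => // k lt_m _.
by rewrite expnAC expnS ltn_pmul2l.
Qed.

Lemma leq_3_up_log4 m : 81 <= m -> 3 ^ up_log 4 m <= m.
Proof.
move=> ge_m; have [le4|] := leqP (up_log 4 m) 4.
  by apply: leq_trans ge_m; rewrite -[81]/(3 ^ 4) leq_exp2l.
have /andP[lt_m _] := @up_log_bounds 4 m isT (leq_trans (isT : 1 < 81) ge_m).
have le34 k : 3 ^ k.+4.+1 <= 4 ^ k.+4.
  by elim: k => // k IHk; rewrite (expnS 3) (expnS 4); lia.
case: (up_log 4 m) lt_m => [|[|[|[|[|k]]]]] // lt_m _.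
exact: leq_trans (le34 k) (ltnW lt_m).
Qed.

Lemma complete_avoiding21_up_log m : 0 < m -> 3 ^ up_log 4 m <= m ->
  exists A : {set Zmod m}, complete_avoiding21 A /\ #|A| ^ 2 < 4 * m.
Proof.
case: m => // p _ le_p.
have [|A [compA leA]] := @complete_avoiding21_exists p (up_log 4 p.+1).
  by rewrite le_p up_logP.
exists A; split=> //; apply: leq_ltn_trans (@up_log4_sqr p.+1 isT).
by rewrite leq_sqr.
Qed.
Local Close Scope nat_scope.

Theorem theorem1p2 (R : realType) :
  [/\ forall m : nat, (1 <= m)%N ->
        exists A : {set Zmod m},
          complete_free_3AP A /\ #|A|%:R < 2 * Num.sqrt (m%:R : R),
      forall m : nat, (81 <= m)%N ->
        exists A : {set Zmod m},
          [/\ complete_free_3AP A, complete_avoiding21 A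
            & #|A|%:R < 2 * Num.sqrt (m%:R : R)],
      forall m : nat, (1 <= m)%N ->
        (a_3AP R (Zmod m) < (2 * Num.sqrt (m%:R : R))%:E)%E
    & forall m : nat, (81 <= m)%N ->
        (a_21 R (Zmod m) < (2 * Num.sqrt (m%:R : R))%:E)%E].
Proof.
have small m : (1 <= m)%N -> exists A : {set Zmod m},
    complete_free_3AP A /\ #|A|%:R < 2 * Num.sqrt (m%:R : R).
  move=> m_gt0; suff [A [cA ltA]] : exists A : {set Zmod m},
      complete_free_3AP A /\ (#|A| ^ 2 < 4 * m)%N.
    by exists A; split=> //; apply: lt_2sqrt.
  have [le_m|lt_m] := boolP (3 ^ up_log 4 m <= m)%N.
    have [A [cA ltA]] := complete_avoiding21_up_log m_gt0 le_m.
    by exists A; split=> //; apply: complete_avoiding21_free_3AP.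
  have lt81 : (m < 81)%N by rewrite ltnNge; apply: contra lt_m => /leq_3_up_log4.
  have := @small_moduli_greedy m; rewrite m_gt0 lt81 (negbTE lt_m) => /(_ isT).
  by case: m m_gt0 {lt_m lt81} => // p _ /greedy_complete.
have large m : (81 <= m)%N -> exists A : {set Zmod m},
    [/\ complete_free_3AP A, complete_avoiding21 A
      & #|A|%:R < 2 * Num.sqrt (m%:R : R)].
  move=> ge_m; have m_gt0 : (0 < m)%N by apply: leq_trans ge_m.
  have [A [cA ltA]] := complete_avoiding21_up_log m_gt0 (leq_3_up_log4 ge_m).
  by exists A; split=> //; [apply: complete_avoiding21_free_3AP | apply: lt_2sqrt].
split=> // m; first by case/small=> A [cA]; apply: min_size_lt.
by case/large=> A [_ cA]; apply: min_size_lt.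
Qed.
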